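(* Let $(\mathcal{A},\varphi)$ be an algebraic probability space and let $K_n^M$ ($n\ge1$) be the monotone joint cumulants. Then for all $n\ge1$ and $X_1,\dots,X_n\in\mathcal{A}$, $$\varphi(X_1\cdots X_n)=\sum_{(\pi,\lambda)\in\mathcal{M}(n)}\frac{1}{|\pi|!}\,K^M_\pi(X_1,\dots,X_n),$$ where $\mathcal{M}(n)$ is the set of monotone partitions of $\{1,\dots,n\}$.
   Context: An algebraic probability space $(\mathcal{A},\varphi)$ is a unital $*$-algebra $\mathcal{A}$ over $\mathbb{C}$ with a state $\varphi$. **Monotone independence.** Let $\Lambda$ be linearly ordered by $<$. $*$-subalgebras $\{\mathcal{A}_\lambda\}_{\lambda\in\Lambda}$ are monotone independent if for all $n\ge2$, $X_i\in\mathcal{A}_{\lambda_i}$ with $\lambda_i\neq\lambda_{i+1}$ ($1\le i\le n-1$), one has $\varphi(X_1\cdots X_i\cdots X_n)=\varphi(X_i)\varphi(X_1\cdots X_{i-1}X_{i+1}\cdots X_n)$ whenever $\lambda_{i-1}<\lambda_i$ and $\lambda_i>\lambda_{i+1}$ (one of the inequalities is dropped when $i=1$ or $i=n$). **Dot operation.** Take copies $\{X^{(j)}\}_{j\ge1}$ of every $X\in\mathcal{A}$ in an algebraic probability space $(\widetilde{\mathcal{A}},\widetilde\varphi)$ such that: $X\mapsto X^{(j)}$ is a (not necessarily unital) $*$-homomorphism $\mathcal{A}\to\widetilde{\mathcal{A}}$ for each $j$; $\widetilde\varphi(X_1^{(j)}\cdots X_n^{(j)})=\varphi(X_1\cdots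 X_n)$ for all $X_i\in\mathcal{A}$, $j,n\ge1$; and the subalgebras $\mathcal{A}^{(j)}=\{X^{(j)}\}_{X\in\mathcal{A}}$, $j\ge1$, are monotone independent (with the natural order on indices). Such copies exist. Put $N.X=X^{(1)}+\cdots+X^{(N)}$, $0.X=0$, and write $\varphi$ for $\widetilde\varphi$. **Monotone cumulants.** $\varphi(N.X_1\cdots N.X_n)$ is a polynomial in $N$ without constant term. $K_n^M(X_1,\dots,X_n)$ is defined as the coefficient of $N$ (the linear coefficient) in it. **Partitions.** A partition $\pi$ of $\{1,\dots,n\}$ is a set $\{V_1,\dots,V_k\}$ of non-empty disjoint blocks with union $\{1,\dots,n\}$; $|\pi|=k$. It is non-crossing if there are no distinct blocks $V,W\in\pi$ with $a,c\in V$, $b,d\in W$, $a<b<c<d$; $\mathcal{NC}(n)$ is the set of non-crossing partitions. For $\pi\in\mathcal{NC}(n)$ and $V,W\in\pi$, write $V\succ W$ if there are $i,j\in W$ with $i<k<j$ for all $k\in V$. An ordered partition is a pair $(\pi,\lambda)$ with $\pi$ a partition and $\lambda$ a linear ordering of its blocks; $V>_\lambda W$ means $V$ is larger than $W$ under $\lambda$. The set of monotone partitions is $$\mathcal{M}(n)=\{(\pi,\lambda)\ \text{ordered partition of }\{1,\dots,n\}:\ \pi\in\mathcal{NC}(n),\ \text{if } V,W\in\pi \text{ satisfy } V\succ W \text{ then } V>_\lambda W\}.$$ For a block $W=\{j_1<\cdots<j_k\}$, $K^M_k(X_W):=K^M_k(X_{j_1},\dots,X_{j_k})$, and $K^M_\pi(X_1,\dots,X_n):=\prod_{V\in\pi}K^M_{|V|}(X_V)$.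 *)

(* Defs.v *)
From mathcomp Require Import all_boot all_order all_algebra.
From mathcomp Require Import complex boolp classical_sets reals.

Set Implicit Arguments.
Unset Strict Implicit.
Unset Printing Implicit Defensive.

Import Order.TTheory GRing.Theory Num.Theory.

Local Open Scope ring_scope.

(* The field of complex numbers is R[i], for R any model of the reals. *)
Record algProbSpace (R : realType) := AlgProbSpace {
  aps_alg :> algType R[i];
  star : aps_alg -> aps_alg;
  state : {scalar aps_alg};
  starD : {morph star : x y / x + y};
  starZ : forall (a : R[i]) (x : aps_alg), star (a *: x) = a^* *: star x;
  starM : forall x y : aps_alg, star (x * y) = star y * star x;
  starK : involutive star;
  state1 : state 1 = 1;
  state_ge0 : forall x : aps_alg, 0 <= state (star x * x)
}.

(* [S] is only ever a family of *-subalgebras below. The hypothesis on each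
   neighbour of [i] is void when [i] has no such neighbour. *)
Definition monotone_indep (R : realType) (B : algProbSpace R)
    (d : Order.disp_t) (L : orderType d) (S : L -> set B) : Prop :=
  forall (n : nat) (l : 'I_n -> L) (X : 'I_n -> B),
    (2 <= n)%N ->
    (forall i, S (l i) (X i)) ->
    (forall i j : 'I_n, j = i.+1 :> nat -> l i != l j) ->
    forall i : 'I_n,
      (forall j : 'I_n, i = j.+1 :> nat -> (l j < l i)%O) ->
      (forall j : 'I_n, j = i.+1 :> nat -> (l j < l i)%O) ->
      state B (\prod_(j < n) X j)
        = state B (X i) * state B (\prod_(j < n | j != i) X j).

(* Copies are numbered from 0: [cp j X] is the copy X^(j+1). *)
Record monotone_copies (R : realType) (A B : algProbSpace R)
    (cp : nat -> A -> B) : Prop := MonotoneCopies {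
  copyD : forall j, {morph cp j : x y / x + y};
  copyZ : forall j (a : R[i]) (x : A), cp j (a *: x) = a *: cp j x;
  copyM : forall j, {morph cp j : x y / x * y};
  copy_star : forall j (x : A), cp j (star x) = star (cp j x);
  copy_state : forall j n (X : 'I_n -> A), (0 < n)%N ->
    state B (\prod_(i < n) cp j (X i)) = state A (\prod_(i < n) X i);
  copy_indep : monotone_indep (fun j : nat => range (cp j))
}.

(* N.X = X^(1) + ... + X^(N) *)
Definition dot (R : realType) (A B : algProbSpace R) (cp : nat -> A -> B)
    (N : nat) (X : A) : B :=
  \sum_(j < N) cp j X.

Definition dot_moment_poly (R : realType) (A B : algProbSpace R)
    (cp : nat -> A -> B) (n : nat) (X : 'I_n -> A) : set {poly R[i]} :=
  [set p : {poly R[i]} | forall N : nat,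
     p.[N%:R] = state B (\prod_(i < n) dot cp N (X i))].

(* There is at most one polynomial to choose from, see [monotone_cumulantE];
   the default 0 is used only if there is none. *)
Definition monotone_cumulant (R : realType) (A B : algProbSpace R)
    (cp : nat -> A -> B) (n : nat) (X : 'I_n -> A) : R[i] :=
  (xget 0 (dot_moment_poly cp X))`_1.

Lemma poly_eq_on_nat (K : numDomainType) (p q : {poly K}) :
  (forall N : nat, p.[N%:R] = q.[N%:R]) -> p = q.
Proof.
move=> pq; apply/eqP; rewrite -subr_eq0; apply/negPn/negP => nz.
pose rs : seq K := [seq i%:R | i <- iota 0 (size (p - q))].
have rootrs : all (root (p - q)) rs.
  by apply/allP => _ /mapP[i _ ->]; rewrite /root !hornerE pq subrr.
have uniqrs : uniq rs.
  by rewrite map_inj_uniq ?iota_uniq // => i j /eqP; rewrite eqr_nat => /eqP.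
by have := max_poly_roots nz rootrs uniqrs; rewrite size_map size_iota ltnn.
Qed.

Lemma monotone_cumulantE (R : realType) (A B : algProbSpace R)
    (cp : nat -> A -> B) (n : nat) (X : 'I_n -> A) (p : {poly R[i]}) :
  dot_moment_poly cp X p -> monotone_cumulant cp X = p`_1.
Proof.
move=> Hp; have Hx : dot_moment_poly cp X (xget 0 (dot_moment_poly cp X)).
  by apply: xgetPex; exists p.
have eqp : xget 0 (dot_moment_poly cp X) = p.
  by apply: poly_eq_on_nat => N; rewrite Hx Hp.
by rewrite /monotone_cumulant eqp.
Qed.

(* [enum_val] lists the elements of [W] in increasing order. *)
Definition block_cumulant (R : realType) (A B : algProbSpace R)
    (cp : nat -> A -> B) (n : nat) (X : 'I_n -> A) (W : {set 'I_n}) : R[i] :=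
  monotone_cumulant cp (fun k : 'I_#|W| => X (enum_val k)).

Definition partition_cumulant (R : realType) (A B : algProbSpace R)
    (cp : nat -> A -> B) (n : nat) (X : 'I_n -> A)
    (pi : {set {set 'I_n}}) : R[i] :=
  \prod_(V in pi) block_cumulant cp X V.

Definition noncrossing (n : nat) (pi : {set {set 'I_n}}) : bool :=
  [forall V in pi, forall W in pi, (V != W) ==>
    ~~ [exists a in V, exists b in W, exists c in V, exists d in W,
          [&& (a < b)%N, (b < c)%N & (c < d)%N]]].

(* V \succ W *)
Definition nested_in (n : nat) (V W : {set 'I_n}) : bool :=
  [exists i in W, exists j in W, forall k in V, (i < k < j)%N].

(* A linear ordering of the elements of [P] is encoded by its strict part:
   [(V, W) \in lam] means that W is larger than V. Since [lam] is a set of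
   pairs of elements of [P], distinct codes are distinct orderings. *)
Definition linear_ordering (T : finType) (P : {set T}) (lam : {set T * T}) :
    bool :=
  [&& lam \subset finset.setX P P,
      [forall V in P, (V, V) \notin lam],
      [forall U in P, forall V in P, forall W in P,
         ((U, V) \in lam) && ((V, W) \in lam) ==> ((U, W) \in lam)]
    & [forall V in P, forall W in P,
         (V != W) ==> ((V, W) \in lam) || ((W, V) \in lam)]].

Definition ordered_partition (n : nat)
    (p : {set {set 'I_n}} * {set {set 'I_n} * {set 'I_n}}) : bool :=
  finset.partition p.1 [set: 'I_n] && linear_ordering p.1 p.2.

Definition monotone_partitions (n : nat) :
    {set {set {set 'I_n}} * {set {set 'I_n} * {set 'I_n}}} :=
  [set p | [&& ordered_partition p, noncrossing p.1
             & [forall V in p.1, forall W in p.1,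
                  nested_in V W ==> ((W, V) \in p.2)]]].

(* Main.v *)
(* For S a subset of the indices, F_S(N) = phi(prod_(i in S) N.X_i) is a
   polynomial in N.  Splitting the first N + M copies into the N lower and the
   M upper ones, and removing the upper letters by monotone independence, gives
     F_S(N + M) = sum_(V \subset S) F_V(N) prod_U F_U(M),
   where U runs over the maximal runs of S \ V between elements of V.  As F_U
   has no constant term for U nonempty, the coefficient of M only retains the
   V for which G = S \ V is a single interval of S, so that
     F_S' = sum_(G interval of S) K(G) F_(S \ G).
   Monotone partitions of S with k + 1 blocks obey the same recursion: their
   largest block is an interval of S, and removing it leaves a monotone
   partition of the rest.  Hence the coefficient of N^k in F_S is 1/k! times the
   sum of K_pi over monotone partitions of S with k blocks; now take N = 1. *)
Require Import Defs.
From mathcomp Require Import all_boot all_order all_algebra.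
From mathcomp Require Import complex boolp classical_sets reals.
(* Imported again because [classical_sets] shadows their names. *)
From mathcomp Require Import fintype finset.

Set Implicit Arguments.
Unset Strict Implicit.
Unset Printing Implicit Defensive.

Import Order.TTheory GRing.Theory Num.Theory.

Local Open Scope ring_scope.

(** * Words in the copies, and removal of letters by monotone independence *)

Section Words.

Variables (R : realType) (A B : algProbSpace R) (cp : nat -> A -> B).
Hypothesis hcp : monotone_copies cp.

Definition word_prod (w : seq (nat * A)) : B := \prod_(z <- w) cp z.1 z.2.

Definition alternating (w : seq (nat * A)) : bool :=
  sorted (fun y z => y.1 != z.1) w.

Lemma word_prod_cat (v w : seq (nat * A)) :
  word_prod (v ++ w) = word_prod v * word_prod w.
Proof. by rewrite /word_prod big_cat. Qed.

(** Monotone independence speaks only of alternating words, so neighbouring letters from the same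
    copy are merged by [copyM]. The arbitrary [d] and [h] make the last clause usable with any test
    on the end indices, the empty word included. *)
Lemma word_prod_compress (w : seq (nat * A)) : exists c : seq (nat * A),
  [/\ alternating c, word_prod c = word_prod w, (size c <= size w)%N,
      {subset [seq z.1 | z <- c] <= [seq z.1 | z <- w]}
    & forall (T : Type) (d : T) (h : nat -> T),
        head d [seq h z.1 | z <- c] = head d [seq h z.1 | z <- w] /\
        last d [seq h z.1 | z <- c] = last d [seq h z.1 | z <- w]].
Proof.
elim: w => [|[a x] w [c [altc prodc sizec subc endc]]]; first by exists [::].
case: c altc prodc sizec subc endc => [|[b y] c] altc prodc sizec subc endc.
  exists [:: (a, x)]; split=> //.
  - by rewrite /word_prod !big_cons -/(word_prod w) -prodc /word_prod big_nil.
  - by move=> k; rewrite /= !inE => ->.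
  - move=> T d h; split=> //=.
    (* The default [true] against the constant [false] forces [w] to be empty. *)
    by case: w {prodc sizec subc} endc => [|e w] // /(_ _ true (fun=> false))[].
have [eab|neab] := eqVneq a b.
  exists ((a, x * y) :: c); split=> //.
  - by move: altc; rewrite /alternating /= {}eab; case: c {prodc sizec subc endc}.
  - rewrite /word_prod !big_cons -/(word_prod w) -prodc /word_prod big_cons /=.
    by rewrite (copyM hcp) eab mulrA.
  - by rewrite (leq_trans sizec) //=.
  - move=> k; rewrite /= !inE => /orP[->//|kc].
    by rewrite subc ?orbT // /= inE kc orbT.
  - move=> T d h; split=> //=.
    by have [_ /= <-] := endc _ (h a) h; rewrite -eab.
exists [:: (a, x), (b, y) & c]; split=> //.
- by move: altc; rewrite /alternating /= neab.
- by rewrite /word_prod big_cons [in RHS]big_cons -/(word_prod w) -prodc.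
- move=> k; rewrite /= inE => /orP[/eqP->|kc]; first by rewrite inE eqxx.
  by rewrite inE subc ?orbT.
- move=> T d h; split=> //=.
  by have [_ /= <-] := endc _ (h a) h.
Qed.

(** The default [true] voids the condition on a side without neighbour. Compressing [v] and [w]
    separately keeps the indices next to [m] below it, so the new word is alternating with a peak at
    position [size c]. *)
Lemma state_word_peak (v w : seq (nat * A)) (m : nat) (x : A) :
    last true [seq (z.1 < m)%N | z <- v] ->
    head true [seq (z.1 < m)%N | z <- w] ->
  state B (word_prod (v ++ (m, x) :: w))
    = state B (cp m x) * state B (word_prod (v ++ w)).
Proof.
have [c [altc prodc _ _ endc]] := word_prod_compress v.
have [e [alte prode _ _ ende]] := word_prod_compress w.
rewrite -(endc bool true (fun a => (a < m)%N)).2.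
rewrite -(ende bool true (fun a => (a < m)%N)).1 => lastc heade.
have prod3 u1 u2 : word_prod (u1 ++ (m, x) :: u2)
    = word_prod u1 * (cp m x * word_prod u2).
  by rewrite word_prod_cat /word_prod big_cons.
rewrite prod3 word_prod_cat -prodc -prode -word_prod_cat -prod3.
(* [monotone_indep] starts at length 2; a lone letter is settled by [state1]. *)
have [|nt] := leqP (size c + size e) 0%N.
  rewrite leqn0 addn_eq0 !size_eq0 => /andP[/eqP-> /eqP->].
  by rewrite /word_prod big_nil big_cons big_nil mulr1 state1 mulr1.
set f := c ++ (m, x) :: e.
have altf : alternating f.
  move: altc alte lastc heade; rewrite /alternating /f.
  rewrite sorted_cat_cons; case: e {prode ende nt f} => [|[b y] e] /=; last first.
    move=> altc -> lastc ltbm; rewrite andbT.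
    rewrite (_ : m != b) ?andbT; last by rewrite gtn_eqF.
    case: c altc lastc {prodc endc} => [|p c] //= altc.
    rewrite rcons_path altc /= (last_map (fun z : nat * A => (z.1 < m)%N)).
    by move=> /ltn_eqF->.
  move=> altc _ lastc _; rewrite andbT.
  case: c altc lastc {prodc endc} => [|p c] //= altc.
  rewrite rcons_path altc /= (last_map (fun z : nat * A => (z.1 < m)%N)).
  by move=> /ltn_eqF->.
have sizef : size f = (size c + size e).+1 by rewrite size_cat /= addnS.
have ltcf : (size c < size f)%N by rewrite sizef ltnS leq_addr.
pose d := (0%N, 0 : A).
pose i0 := Ordinal ltcf.
have nthi0 : nth d f i0 = (m, x) by rewrite nth_cat ltnn subnn.
have := @copy_indep _ _ _ _ hcp (size f) (fun i => (nth d f i).1)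
  (fun i => cp (nth d f i).1 (nth d f i).2).
rewrite sizef ltnS nt -sizef => /(_ isT) indep.
have {indep} := indep _ _ i0.
have -> : \prod_(j < size f) cp (nth d f j).1 (nth d f j).2 = word_prod f.
  by rewrite /word_prod (big_nth d) big_mkord.
have -> : \prod_(j < size f | j != i0) cp (nth d f j).1 (nth d f j).2
    = word_prod (c ++ e).
  rewrite -(big_mkord (fun j => j != size c)
     (fun j => cp (nth d f j).1 (nth d f j).2)).
  rewrite (@big_cat_nat _ _ _ (size c)) //= 1?ltnW //.
  rewrite [X in _ * X]big_ltn_cond // eqxx /=.
  rewrite word_prod_cat /word_prod !(big_nth d); congr (_ * _).
    rewrite big_nat_cond [RHS]big_nat_cond; apply: eq_big => j.
      by rewrite ltnNge /= andbT; case: ltngtP.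
    by rewrite /f nth_cat => /andP[/andP[_ ->]].
  rewrite sizef -[(size c).+1 in X in X = _]add0n big_addn subSS addKn.
  rewrite big_nat_cond [RHS]big_nat_cond; apply: eq_big => j.
    by rewrite addnS gtn_eqF ?andbT // ltnS leq_addl.
  move=> _; rewrite /f nth_cat addnS.
  by rewrite ltnNge leqW ?leq_addl //= subSn ?leq_addl // addnK.
rewrite nthi0 /=; apply.
- by move=> i; exists (nth d f i).2.
- move=> i j eij; move: altf; rewrite /alternating => /(sortedP d).
  move=> /(_ i); rewrite eij; apply.
  by rewrite -eij.
- move=> j ej; rewrite nth_cat ej ltnS leqnn.
  move: lastc; rewrite (last_nth true) size_map ej /=.
  by rewrite (nth_map d) // ej.
- move=> j ej; rewrite nth_cat ej ltnNge leqnSn /= subSn // subnn /=.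
  have := ltn_ord j; rewrite ej sizef ltnS -addn1 leq_add2l.
  by move: heade; case: (e) => //.
Qed.

(** Induction on the length of [g]: after compression, a letter of largest index is a peak of [g]
    and also of the whole word, whose outer neighbours lie below [N]. Removing it extracts the same
    factor from both sides of the equation. *)
Lemma state_word_threshold (N : nat) (v g w : seq (nat * A)) :
    all (fun z => N <= z.1)%N g ->
    last true [seq (z.1 < N)%N | z <- v] ->
    head true [seq (z.1 < N)%N | z <- w] ->
  state B (word_prod (v ++ g ++ w))
    = state B (word_prod g) * state B (word_prod (v ++ w)).
Proof.
have [k] := ubnP (size g); elim: k => // k IHk in g *.
rewrite ltnS => sizeg allg lastv headw.
have [c [altc prodc sizec subc _]] := word_prod_compress g.
have {}allc : all (fun z => N <= z.1)%N c.
  apply/allP => z zc; move/allP: allg.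
  have /mapP[y yg ->] := subc _ (map_f (fun z => z.1) zc); exact.
rewrite !word_prod_cat -prodc -!word_prod_cat.
have {}sizec := leq_trans sizec sizeg.
have [->|nz] := eqVneq c [::].
  by rewrite /word_prod big_nil state1 mul1r.
have [z0 z0c maxz] : exists2 z0, z0 \in c & forall z, z \in c -> (z.1 <= z0.1)%N.
  elim: (c) nz => // z [|y c'] IHc _.
    by exists z; rewrite ?inE // => y /[!inE] /eqP->.
  have [//|z1 z1c maxz] := IHc.
  have [le|lt] := leqP z.1 z1.1.
    exists z1; first by rewrite inE z1c orbT.
    by move=> u; rewrite inE => /orP[/eqP->|/maxz].
  exists z; first by rewrite inE eqxx.
  move=> u; rewrite inE => /orP[/eqP->//|/maxz ule].
  exact: leq_trans ule (ltnW lt).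
have [c1 [c2 def_c]] : exists c1, exists c2, c = c1 ++ z0 :: c2.
  by case/splitPr: z0c => c1 c2; exists c1, c2.
case: z0 maxz {z0c} def_c => m x /= maxz def_c.
(* The default [u] is [true] when [c] stands alone, and the condition on the last letter of [v]
   inside the long word. *)
have lastc1 (u : bool) : u -> last u [seq (z.1 < m)%N | z <- c1].
  move=> hu; case/lastP: c1 def_c => [//|c1 z] def_c.
  rewrite map_rcons last_rcons ltn_neqAle maxz ?def_c; last first.
    by rewrite mem_cat mem_rcons inE eqxx.
  move: altc; rewrite /alternating def_c sorted_cat_cons.
  rewrite andbT => /andP[+ _]; case: (c1) => [|p q] /=; first by rewrite andbT.
  by rewrite rcons_path last_rcons => /andP[].
have headc2 (u : bool) : u -> head u [seq (z.1 < m)%N | z <- c2].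
  move=> hu; case: c2 def_c => [//|z c2] def_c /=.
  rewrite ltn_neqAle maxz ?def_c; last by rewrite mem_cat !inE eqxx !orbT.
  move: altc; rewrite /alternating def_c sorted_cat_cons => /andP[_] /=.
  by rewrite eq_sym => /andP[->].
have leNm : (N <= m)%N.
  by move/allP: allc => /(_ (m, x)); apply; rewrite def_c mem_cat inE eqxx orbT.
have -> : v ++ c ++ w = (v ++ c1) ++ (m, x) :: (c2 ++ w).
  by rewrite def_c -!catA.
rewrite state_word_peak; first last.
- rewrite map_cat; case: (c2) headc2 => [_|z c2' /(_ true isT)//] /=.
  by case: (w) headw => //= z ? /leq_trans; apply.
- rewrite map_cat last_cat; apply: lastc1.
  case/lastP: (v) lastv => // v' z; rewrite !map_rcons !last_rcons.
  by move=> /leq_trans; apply.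
rewrite def_c (state_word_peak x (lastc1 _ isT) (headc2 _ isT)) -mulrA.
congr (_ * _); rewrite -IHk //.
- by rewrite -!catA.
- by move: sizec; rewrite def_c !size_cat /= addnS.
- by move: allc; rewrite def_c !all_cat /= => /and3P[-> _ ->].
Qed.

End Words.

(** * Sums of words with a common pattern of lower and upper letters *)

Section Spans.

Variables (R : realType) (A B : algProbSpace R) (cp : nat -> A -> B).
Hypothesis hcp : monotone_copies cp.

Definition word_span (P : pred (seq (nat * A))) (b : B) : Prop :=
  exists2 s : seq (seq (nat * A)), all P s & b = \sum_(w <- s) word_prod cp w.

Lemma word_span_prod (I : Type) (N : nat) (V : pred I) (Y : I -> B)
    (s : seq I) :
    (forall i, word_span (fun w => [seq (z.1 < N)%N | z <- w] == [:: V i]) (Y i)) ->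
  word_span (fun w => [seq (z.1 < N)%N | z <- w] == [seq V i | i <- s])
    (\prod_(i <- s) Y i).
Proof.
move=> spanY; elim: s => [|i s [ws allws IHs]].
  by exists [:: [::]]; rewrite //= big_nil big_seq1 /word_prod big_nil.
have [vs allvs def_vs] := spanY i.
exists [seq v ++ w | v <- vs, w <- ws].
  apply/allP => _ /allpairsP[[v w] /= [vvs wws ->]].
  rewrite map_cat (eqP (allP allws _ wws)).
  by move: (allP allvs _ vvs) => /eqP->.
rewrite big_cons IHs def_vs big_allpairs_dep /= mulr_suml.
apply: eq_bigr => v _; rewrite mulr_sumr.
by apply: eq_bigr => w _; rewrite word_prod_cat.
Qed.

(** By linearity one word may be taken from each of the three products; all of them follow the
    pattern [V], so [state_word_threshold] applies. *)
Lemma state_threshold (I : Type) (N : nat) (V : pred I) (Y : I -> B)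
    (s1 g s2 : seq I) :
    (forall i, word_span (fun w => [seq (z.1 < N)%N | z <- w] == [:: V i]) (Y i)) ->
    all (predC V) g -> last true (map V s1) -> head true (map V s2) ->
  state B (\prod_(i <- s1 ++ g ++ s2) Y i)
    = state B (\prod_(i <- g) Y i) * state B (\prod_(i <- s1 ++ s2) Y i).
Proof.
move=> spanY allg lasts heads.
have [ws1 all1 def1] := word_span_prod s1 spanY.
have [ws2 all2 def2] := word_span_prod s2 spanY.
have [wsg allwg defg] := word_span_prod g spanY.
rewrite !big_cat /= def1 !mulr_suml !linear_sum mulr_sumr !big_seq.
apply: eq_bigr => u us; rewrite defg mulr_suml mulr_sumr !linear_sum mulr_suml.
rewrite !big_seq; apply: eq_bigr => h hs.
rewrite def2 !mulr_sumr !linear_sum mulr_sumr !big_seq; apply: eq_bigr => w ws.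
rewrite -!word_prod_cat; apply: (state_word_threshold hcp (N := N)).
- have: all negb [seq (z.1 < N)%N | z <- h].
    by rewrite (eqP (allP allwg _ hs)) all_map.
  by rewrite all_map; apply: sub_all => z /=; rewrite -leqNgt.
- by move: lasts; have /eqP <- := allP all1 _ us.
- by move: heads; have /eqP <- := allP all2 _ ws.
Qed.

End Spans.

(** * Gaps left in a set of indices by a subset *)

Section Gaps.

Variable n : nat.
Implicit Types (S V G : {set 'I_n}) (x y : 'I_n).

(* [last_below V y] is 0 when [y] has no element of [V] below it, and one more
   than the largest such element otherwise. *)
Definition last_below V y : nat := \max_(v in V | (v < y)%N) v.+1.

(** For [V] inside [S], the nonempty gaps are the maximal runs of [S :\: V] between elements of [V].
    Their indices are below [n] since [last_below V y] is at most [y]. *)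
Definition gap V S (k : nat) : {set 'I_n} :=
  [set y in S :\: V | last_below V y == k].

Lemma last_below_gt V v y : v \in V -> (v < y)%N -> (v < last_below V y)%N.
Proof.
move=> vV vy; rewrite /last_below.
by apply: (@leq_bigmax_cond _ _ (fun u : 'I_n => u.+1)); rewrite vV.
Qed.

Lemma last_below_le V y : (last_below V y <= y)%N.
Proof. by apply/bigmax_leqP => v /andP[]. Qed.

Lemma last_below_mono V x y : (x <= y)%N -> (last_below V x <= last_below V y)%N.
Proof.
move=> lexy; apply/bigmax_leqP => v /andP[vV vx].
by apply: last_below_gt => //; apply: leq_trans lexy.
Qed.

Lemma last_below_attained V y : (0 < last_below V y)%N ->
  exists2 v, v \in V & (v < y)%N /\ last_below V y = v.+1.
Proof.
rewrite /last_below; elim/big_ind: _ => // [a b Ha Hb|v /andP[vV vy] _].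
  by rewrite /maxn; case: ifP.
by exists v.
Qed.

Lemma sorted_enum (P : pred 'I_n) : sorted (fun x y => x < y)%N (enum P).
Proof.
rewrite {1}/enum_mem -enumT; apply: sorted_filter; first exact: (fun y x z => @ltn_trans y x z).
have := iota_ltn_sorted 0 n; rewrite -val_enum_ord sorted_map; exact.
Qed.

Lemma sorted_filter_split (P : pred 'I_n) (s : seq 'I_n) :
    sorted (fun x y => x < y)%N s ->
    {in s &, forall x y, P x -> ~~ P y -> (x < y)%N} ->
  s = [seq x <- s | P x] ++ [seq x <- s | ~~ P x].
Proof.
have tr : transitive (fun x y : 'I_n => x < y)%N by move=> y x z; apply: ltn_trans.
move=> sorteds ltP; apply: (@irr_sorted_eq _ (fun x y : 'I_n => x < y)%N) => //.
- by move=> x; apply: ltnn.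
- rewrite (sorted_pairwise tr) pairwise_cat -!(sorted_pairwise tr).
  rewrite !sorted_filter // !andbT; apply/allrelP => x y.
  by rewrite !mem_filter => /andP[Px xs] /andP[Py ys]; apply: ltP.
- by move=> x; rewrite mem_cat !mem_filter -andb_orl orbN.
Qed.

(** [U] consists of [V] and the gaps of index at least [m]. Its elements below [m] form [s1], and
    gap [m] comes next; it thus has only neighbours in [V], as [state_threshold] requires. *)
Lemma enum_gap V S (m : nat) : V \subset S -> exists s1 s2 : seq 'I_n,
  let U := [set y in S | (y \in V) || (m <= last_below V y)%N] in
  [/\ enum U = s1 ++ enum (gap V S m) ++ s2,
      enum [set y in S | (y \in V) || (m < last_below V y)%N] = s1 ++ s2,
      all (mem V) s1 & head true (map (mem V) s2)].
Proof.
move=> subVS; set U := [set y in S | (y \in V) || (m <= last_below V y)%N].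
have sortU := sorted_enum (mem U).
pose s1 := [seq x : 'I_n <- enum U | (x < m)%N].
pose r := [seq x : 'I_n <- enum U | ~~ (x < m)%N].
pose P x := x \in gap V S m.
pose s2 := [seq x <- r | ~~ P x].
have EU : enum U = s1 ++ r.
  apply: (sorted_filter_split (P := fun x : 'I_n => (x < m)%N)) => // x y _ _ lt.
  by rewrite -leqNgt; apply: leq_trans.
have sortr : sorted (fun x y => x < y)%N r.
  by apply: sorted_filter sortU => y x z; apply: ltn_trans.
have ltgap x y : x \in gap V S m -> y \in r -> ~~ P y -> (x < y)%N.
  rewrite /P !inE mem_filter mem_enum inE -leqNgt.
  move=> /andP[/andP[xV xS] /eqP lbx] /and3P[ley yS].
  rewrite yS andbT negb_and negbK; case/orP=> [yV _|leby].
    rewrite ltnNge leq_eqVlt; apply/negP => /orP[/eqP/val_inj eyx|ltyx].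
      by rewrite -eyx yV in xV.
    by have := last_below_gt yV ltyx; rewrite lbx ltnNge ley.
  case/orP=> [yV|neq].
    rewrite ltnNge leq_eqVlt; apply/negP => /orP[/eqP/val_inj eyx|ltyx].
      by rewrite -eyx yV in xV.
    by have := last_below_gt yV ltyx; rewrite lbx ltnNge ley.
  rewrite ltnNge; apply/negP => /(last_below_mono V); rewrite lbx => leyx.
  by rewrite eqn_leq leby leyx in neq.
have Er : r = [seq x <- r | P x] ++ s2.
  by apply: (sorted_filter_split sortr) => x y _ yr Px; apply: ltgap.
have Eg : [seq x <- r | P x] = enum (gap V S m).
  apply: (@irr_sorted_eq _ (fun x y : 'I_n => x < y)%N).
  - by move=> y x z; apply: ltn_trans.
  - by move=> x; apply: ltnn.
  - by apply: sorted_filter sortr => y x z; apply: ltn_trans.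
  - exact: sorted_enum.
  - move=> x; rewrite mem_enum 2!mem_filter !mem_enum /P !inE -leqNgt.
    case: eqP => [lbx|]; rewrite ?andbF // -lbx leqnn last_below_le orbT.
    by case: (x \in V); case: (x \in S).
have subs1 : all (mem V) s1.
  apply/allP => x; rewrite mem_filter mem_enum inE /= => /and3P[ltxm _ /orP[//|]].
  by move=> /leq_trans/(_ (last_below_le V x)); rewrite leqNgt ltxm.
exists s1, s2; split=> //.
- by rewrite EU {1}Er Eg.
- apply: (@irr_sorted_eq _ (fun x y : 'I_n => x < y)%N).
  - by move=> y x z; apply: ltn_trans.
  - by move=> x; apply: ltnn.
  - exact: sorted_enum.
  - have tr : transitive (fun x y : 'I_n => x < y)%N by move=> y x z; apply: ltn_trans.
    apply: (subseq_sorted tr _ sortU); rewrite EU.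
    by apply: cat_subseq => //; apply: filter_subseq.
  - move=> x; rewrite mem_enum mem_cat (mem_filter (mem [pred y : 'I_n | (y < m)%N])).
    rewrite /s2 (mem_filter [pred y | ~~ P y]).
    rewrite (mem_filter [pred y : 'I_n | ~~ (y < m)%N]) !mem_enum /P !inE /=.
    have := last_below_le V x; case: ltngtP => // lbx; case: ltnP => //=;
      case: (x \in V); case: (x \in S) => //= ltxm.
    by rewrite -lbx leqNgt ltxm.
- move def_s: s2 => s; case: s def_s => [//|y s] def_s2 /=.
  have: y \in s2 by rewrite def_s2 inE eqxx.
  rewrite (mem_filter [pred y | ~~ P y]) => /andP[nPy yr]; apply/negPn/negP => nyV.
  have: y \in enum U by rewrite EU mem_cat yr orbT.
  rewrite mem_enum inE (negPf nyV) /= => /andP[yS leby].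
  move: (nPy); rewrite /P !inE nyV yS /= => neq.
  have ltby : (m < last_below V y)%N by rewrite ltn_neqAle eq_sym neq.
  (* If [s2] started at some [y] outside [V], the last element [v] of [V] below [y] would be at
     least [m], hence lie in [s2] before its head. *)
  have [v vV [ltvy eqv]] := last_below_attained (leq_ltn_trans (leq0n m) ltby).
  have vs2 : v \in s2.
    rewrite mem_filter /r mem_filter mem_enum /P !inE vV /=.
    by rewrite -leqNgt -ltnS -eqv ltby (subsetP subVS).
  have : path (fun x y : 'I_n => x < y)%N y s.
    suff: sorted (fun x y : 'I_n => x < y)%N s2 by rewrite def_s2.
    by apply: sorted_filter sortr => ? ? ?; apply: ltn_trans.
  move=> /order_path_min-/(_ (fun b a c => @ltn_trans b a c))/allP/(_ v).
  move: vs2; rewrite def_s2 inE => /orP[/eqP eqvy|vs /(_ vs)].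
    by rewrite -eqvy vV in nyV.
  by rewrite ltnNge ltnW.
Qed.

End Gaps.

(** * Factorization of the state over all gaps *)

Section GapStates.

Variables (R : realType) (A B : algProbSpace R) (cp : nat -> A -> B).
Hypothesis hcp : monotone_copies cp.

Lemma big_enum_ordered (T : Type) (x : T) (op : T -> T -> T) (I : finType)
    (P : {set I}) (F : I -> T) :
  \big[op/x]_(i <- enum P) F i = \big[op/x]_(i in P) F i.
Proof. by rewrite -[RHS]big_filter [index_enum I]unlock. Qed.

(** Gaps are stripped off by increasing index, [U m] being what remains after the first [m]; [U n]
    is [V]. Empty gaps contribute the factor 1. *)
Lemma state_gaps (n N : nat) (V S : {set 'I_n}) (Y : 'I_n -> B) :
    V \subset S ->
    (forall i, word_span cp
       (fun w => [seq (z.1 < N)%N | z <- w] == [:: i \in V]) (Y i)) ->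
  state B (\prod_(i in S) Y i)
    = state B (\prod_(i in V) Y i)
      * \prod_(k < n) state B (\prod_(i in gap V S k) Y i).
Proof.
move=> subVS spanY.
pose U m := [set y in S | (y \in V) || (m <= last_below V y)%N].
suff rec m : state B (\prod_(i in S) Y i) = state B (\prod_(i in U m) Y i)
      * \prod_(k < m) state B (\prod_(i in gap V S k) Y i).
  rewrite (rec n); congr (state B _ * _); apply: eq_bigl => i.
  rewrite inE leqNgt (leq_ltn_trans (last_below_le V i)) //= orbF.
  by case: (boolP (i \in V)) => [/(subsetP subVS)->|]; rewrite ?andbF.
elim: m => [|m ->].
  rewrite big_ord0 mulr1; congr (state B _); apply: eq_bigl => i.
  by rewrite inE orbT andbT.
rewrite big_ord_recr /=; suff ->: state B (\prod_(i in U m) Y i)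
    = state B (\prod_(i in gap V S m) Y i) * state B (\prod_(i in U m.+1) Y i).
  by rewrite -[LHS]mulrA [LHS]mulrC -mulrA.
have [s1 [s2 [/= enumU enumU1 allV headV]]] := enum_gap m subVS.
rewrite -big_enum_ordered /U enumU (state_threshold hcp spanY); first last.
- exact: headV.
- case/lastP: s1 allV {enumU enumU1} => // s1 z.
  by rewrite map_rcons last_rcons all_rcons => /andP[].
- by apply/allP => x; rewrite mem_enum !inE => /andP[/andP[]].
by rewrite -enumU1 !big_enum_ordered.
Qed.

End GapStates.

(** * Ordered products in a ring without commutativity *)

Lemma prodr_zero_factor (T : pzRingType) (I : eqType) (s : seq I) (F : I -> T)
    (i : I) : i \in s -> F i = 0 -> \prod_(j <- s) F j = 0.
Proof.
move=> + Fi0; elim: s => // j s IHs; rewrite inE big_cons.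
by case/orP=> [/eqP<-|/IHs->]; rewrite ?Fi0 ?mul0r ?mulr0.
Qed.

Lemma prodrD_subsets (T : pzRingType) (I : finType) (S : {set I})
    (D E : I -> T) :
  \prod_(i in S) (D i + E i)
    = \sum_(V : {set I} | V \subset S)
        \prod_(i in S) (if i \in V then D i else E i).
Proof.
rewrite big_mkcond /=.
(* Outside [S] the factor 1 is split as 0 + 1, which kills the terms where [V] leaves [S]. *)
have split_i i : (if i \in S then D i + E i else 1)
    = (if i \in S then D i else 0) + (if i \in S then E i else 1).
  by case: ifP; rewrite ?add0r.
rewrite (eq_bigr _ (fun i _ => split_i i)) bigA_distr.
rewrite (bigID (fun V : {set I} => V \subset S)) /=.
rewrite [X in _ + X]big1 ?addr0 => [|V /subsetPn[i iV niS]]; last first.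
  by apply: (@prodr_zero_factor _ _ _ _ i); rewrite ?mem_index_enum // iV (negPf niS).
apply: eq_bigr => V /subsetP subVS; rewrite [RHS]big_mkcond; apply: eq_bigr => i _.
by have [/subVS->|] := boolP (i \in V).
Qed.

(** * Moments of the dot operation as functions of the number of copies *)

Section DotMoments.

Variables (R : realType) (A B : algProbSpace R).
Implicit Types cp : nat -> A -> B.

Lemma monotone_copies_shift cp (N : nat) :
  monotone_copies cp -> monotone_copies (fun j => cp (N + j)%N).
Proof.
move=> hcp; split=> [j|j|j|j|j n X n0|n l X n2 Xl altl i ltl ltr].
- exact: copyD.
- exact: (copyZ hcp).
- exact: copyM.
- exact: (copy_star hcp).
- exact: copy_state.
apply: (copy_indep hcp (l := fun i => (N + l i)%N)) => //.
- by move=> i1 i2 /altl; rewrite eqn_add2l.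
- by move=> j /ltl; rewrite ltEnat /= ltn_add2l.
- by move=> j /ltr; rewrite ltEnat /= ltn_add2l.
Qed.

Definition dot_moment cp (n : nat) (X : 'I_n -> A) (N : nat) (S : {set 'I_n}) :
    R[i] :=
  state B (\prod_(i in S) dot cp N (X i)).

Variables (n : nat) (X : 'I_n -> A).
Implicit Types (S V G : {set 'I_n}).

(** [V] collects the positions that contribute their lower part; the others fall into gaps, which
    [state_gaps] factors out. *)
Lemma dot_moment_add cp (N M : nat) S : monotone_copies cp ->
  dot_moment cp X (N + M) S
    = \sum_(V : {set 'I_n} | V \subset S) dot_moment cp X N V
        * \prod_(k < n) dot_moment (fun j => cp (N + j)%N) X M (gap V S k).
Proof.
move=> hcp; rewrite /dot_moment.
under eq_bigr do rewrite /dot big_split_ord /=.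
rewrite prodrD_subsets linear_sum; apply: eq_bigr => V subVS.
pose Y i := if i \in V then dot cp N (X i)
            else dot (fun j => cp (N + j)%N) M (X i).
rewrite (state_gaps (N := N) (Y := Y) hcp subVS) => [|i].
  congr (state B _ * _); first by apply: eq_bigr => i iV; rewrite /Y iV.
  apply: eq_bigr => k _; congr (state B _); apply: eq_bigr => i.
  by rewrite inE => /andP[/setDP[_ niV] _]; rewrite /Y (negPf niV).
rewrite /Y; case: (i \in V).
  exists [seq [:: (val j, X i)] | j : 'I_N <- index_enum _].
    by rewrite all_map; apply/allP => j _ /=; rewrite ltn_ord.
  by rewrite big_map; apply: eq_bigr => j _; rewrite /word_prod big_seq1.
exists [seq [:: (N + j, X i)%N] | j : 'I_M <- index_enum _].
  by rewrite all_map; apply/allP => j _ /=; rewrite ltnNge leq_addr.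
by rewrite big_map; apply: eq_bigr => j _; rewrite /word_prod big_seq1.
Qed.

Lemma dot_moment0 cp S : dot_moment cp X 0 S = (S == set0)%:R.
Proof.
rewrite /dot_moment; have [->|/set0Pn[i iS]] := eqVneq S set0.
  by rewrite big_set0 state1.
rewrite -big_enum_ordered (@prodr_zero_factor _ _ _ _ i) ?mem_enum ?linear0 //.
by rewrite /dot big_ord0.
Qed.

Lemma dot_moment_set0 cp N : dot_moment cp X N set0 = 1.
Proof. by rewrite /dot_moment big_set0 state1. Qed.

Lemma prod_enum_val (T : pzRingType) (S : {set 'I_n}) (F : 'I_n -> T) :
  \prod_(i in S) F i = \prod_(k < #|S|) F (enum_val k).
Proof.
rewrite -big_enum_ordered (big_tuple _ _ (enum_tuple S)).
by apply: eq_bigr => k _; rewrite (tnth_nth (enum_default k)).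
Qed.

Definition moment S : R[i] := state A (\prod_(i in S) X i).

Lemma dot_moment1 cp S : monotone_copies cp -> dot_moment cp X 1 S = moment S.
Proof.
move=> hcp; rewrite /dot_moment /moment.
have [->|nz] := eqVneq S set0; first by rewrite !big_set0 !state1.
under eq_bigr do rewrite /dot big_ord1.
rewrite !prod_enum_val. by rewrite (copy_state hcp) ?card_gt0.
Qed.

(** When copies are added one at a time, each increment involves only moments of a single copy,
    which are moments in [A]. Shifted copies may thus replace the original ones. *)
Lemma dot_moment_copies cp cp' (N : nat) S :
  monotone_copies cp -> monotone_copies cp' ->
  dot_moment cp X N S = dot_moment cp' X N S.
Proof.
move=> hcp hcp'; elim: N S => [|N IHN] S; first by rewrite !dot_moment0.
rewrite -addn1 !dot_moment_add //; apply: eq_bigr => V _; rewrite IHN.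
congr (_ * _); apply: eq_bigr => k _.
by rewrite !dot_moment1 //; apply: monotone_copies_shift.
Qed.

End DotMoments.

(** * Binomial coefficients as polynomials, and a vanishing linear coefficient *)

Section BinomialPolynomials.

Variable F : numFieldType.

Definition binomial_poly (k : nat) : {poly F} :=
  (k`!%:R)^-1 *: \prod_(i < k) ('X - (i%:R)%:P).

Lemma horner_binomial_poly (k N : nat) :
  (binomial_poly k).[N%:R] = 'C(N, k)%:R.
Proof.
suff ffactE : (\prod_(i < k) ('X - (i%:R)%:P)).[N%:R] = (N ^_ k)%:R :> F.
  by rewrite hornerZ ffactE -bin_ffact natrM mulrC mulfK // pnatr_eq0 -lt0n fact_gt0.
elim: k => [|k IHk]; first by rewrite big_ord0 hornerC.
rewrite big_ord_recr hornerM IHk ffactnSr natrM !hornerE /=.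
(* For [N < k] the truncated [N - k] is wrong, but the falling factorial is 0. *)
by have [/natrB->//|ltNk] := leqP k N; rewrite ffact_small ?mul0r.
Qed.

(** Two factors divisible by ['X] make the product divisible by its square. *)
Lemma coef1_prod_two_roots (I : finType) (Q : I -> {poly F}) (a b : I) :
  a != b -> (Q a)`_0 = 0 -> (Q b)`_0 = 0 -> (\prod_i Q i)`_1 = 0.
Proof.
move=> neab Qa0 Qb0; rewrite (bigD1 a) //= (bigD1 b) 1?eq_sym //=.
by rewrite !coefM !big_ord_recl !big_ord0 /= !coefM !big_ord_recl !big_ord0 /=
  Qa0 Qb0 !(mul0r, mulr0, addr0).
Qed.

End BinomialPolynomials.

(** * Intervals of a set as complements with a single gap *)

Section GapSets.

Variable n : nat.
Implicit Types (S V G : {set 'I_n}).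

Lemma gap_id S k : gap S S k = set0.
Proof. by apply/setP => i; rewrite !inE andNb. Qed.

(** Intervals are relative to [S]: indices outside [S] may separate elements of [G], as happens once
    blocks have been removed. *)
Definition interval_of G S : bool :=
  [&& G != set0, G \subset S
    & [forall a in G, forall b in G, forall c in S,
         (a < c)%N && (c < b)%N ==> (c \in G)]].

Lemma interval_ofP G S : reflect
  [/\ G != set0, G \subset S & forall a b c : 'I_n, a \in G -> b \in G -> c \in S ->
     (a < c)%N -> (c < b)%N -> c \in G] (interval_of G S).
Proof.
apply: (iffP and3P) => -[nzG subGS int]; split=> //.
  move=> a b c aG bG cS ltac ltcb.
  move: int => /forall_inP/(_ a aG)/forall_inP/(_ b bG)/forall_inP/(_ c cS).
  by rewrite ltac ltcb.
apply/forall_inP => a aG; apply/forall_inP => b bG; apply/forall_inP => c cS.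
by apply/implyP => /andP[]; apply: int.
Qed.

Lemma mem_gap_setD G S k (y : 'I_n) : G \subset S ->
  (y \in gap (S :\: G) S k) = (y \in G) && (last_below (S :\: G) y == k).
Proof.
move=> /subsetP subGS; rewrite !inE; congr (_ && _).
by have [/subGS->|] := boolP (y \in G); rewrite //= ; case: (y \in S).
Qed.

(** No element of [S :\: G] lies between two elements of [G], so [last_below (S :\: G)] is constant
    on [G]. *)
Lemma gap_interval G S : interval_of G S ->
  exists k0 : 'I_n, forall k : 'I_n,
    gap (S :\: G) S k = if k == k0 then G else set0.
Proof.
case/interval_ofP=> /set0Pn[y0 y0G] subGS int.
have lb_le (y y' : 'I_n) : y \in G -> y' \in G ->
    (last_below (S :\: G) y <= last_below (S :\: G) y')%N.
  move=> yG y'G; have [/last_below_mono|lty'y] := leqP y y'; first exact.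
  apply/bigmax_leqP => v /andP[vV ltvy]; apply: last_below_gt => //.
  move: vV; rewrite inE => /andP[nvG vS]; rewrite ltnNge leq_eqVlt.
  apply: contra nvG => /orP[/eqP/val_inj<-//|lty'v].
  exact: int y'G yG vS lty'v ltvy.
exists (Ordinal (leq_ltn_trans (last_below_le (S :\: G) y0) (ltn_ord y0))) => k.
apply/setP => y; rewrite mem_gap_setD //.
have [yG|nyG] /= := boolP (y \in G); last by case: ifP; rewrite ?inE ?(negPf nyG).
have -> : last_below (S :\: G) y = last_below (S :\: G) y0.
  by apply/eqP; rewrite eqn_leq !lb_le.
by rewrite -val_eqE /= eq_sym; case: eqP; rewrite ?inE.
Qed.

(** A missing [c] between [a] and [b] separates their gaps: [last_below] is at most [a] at [a] and
    exceeds [c] at [b]. *)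
Lemma gap_not_interval G S :
    G \subset S -> G != set0 -> ~~ interval_of G S ->
  exists k1 k2 : 'I_n,
    [/\ k1 != k2, gap (S :\: G) S k1 != set0 & gap (S :\: G) S k2 != set0].
Proof.
move=> subGS nzG; rewrite /interval_of nzG subGS /=.
rewrite negb_forall_in => /exists_inP[a aG]; rewrite negb_forall_in.
move=> /exists_inP[b bG]; rewrite negb_forall_in => /exists_inP[c cS].
rewrite negb_imply => /andP[/andP[ltac ltcb] ncG].
have lb_lt y : (last_below (S :\: G) y < n)%N.
  exact: leq_ltn_trans (last_below_le _ y) (ltn_ord y).
exists (Ordinal (lb_lt a)), (Ordinal (lb_lt b)); split.
- rewrite -val_eqE /= neq_ltn (leq_ltn_trans (last_below_le _ a)) //.
  by apply: (ltn_trans ltac); apply: last_below_gt; rewrite // inE ncG.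
- by apply/set0Pn; exists a; rewrite mem_gap_setD // aG eqxx.
- by apply/set0Pn; exists b; rewrite mem_gap_setD // bG eqxx.
Qed.

End GapSets.

(** * The moment polynomials and their derivatives *)

Section DotPolynomials.

Variables (R : realType) (A B : algProbSpace R) (cp : nat -> A -> B).
Hypothesis hcp : monotone_copies cp.
Variables (n : nat) (X : 'I_n -> A).
Implicit Types (S V G : {set 'I_n}).

Definition gap_weight V S : R[i] := \prod_(k < n) moment X (gap V S k).

Lemma dot_momentS (N : nat) S :
  dot_moment cp X N.+1 S = dot_moment cp X N S
    + \sum_(V : {set 'I_n} | V \proper S) dot_moment cp X N V * gap_weight V S.
Proof.
rewrite -addn1 dot_moment_add // (bigD1 S) //=; congr (_ + _).
  rewrite big1 ?mulr1 // => k _.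
  by rewrite gap_id dot_moment_set0.
apply: eq_big => [V|V _]; first by rewrite properEneq andbC.
congr (_ * _); apply: eq_bigr => k _; rewrite dot_moment1 //.
exact: monotone_copies_shift.
Qed.

(* The coefficients of [N |-> dot_moment cp X N S] in Newton's basis of
   binomial coefficients. *)
Fixpoint newton_coef (k : nat) S : R[i] :=
  if k is k'.+1 then
    \sum_(V : {set 'I_n} | V \proper S) newton_coef k' V * gap_weight V S
  else (S == set0)%:R.

(** [newton_coef k S] is a weighted sum over strictly increasing chains of [k] steps from the empty
    set to [S]; such a chain needs at least [k] elements in [S]. *)
Lemma newton_coef_large (k : nat) S : (#|S| < k)%N -> newton_coef k S = 0.
Proof.
elim: k S => // k IHk S ltSk /=; apply: big1 => V /proper_card ltVS.
by rewrite IHk ?mul0r // (leq_trans ltVS).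
Qed.

(** Pascal's rule turns [dot_momentS] into the recursion of [newton_coef]. *)
Lemma dot_moment_newton (N : nat) S :
  dot_moment cp X N S = \sum_(k < n.+1) 'C(N, k)%:R * newton_coef k S.
Proof.
elim: N S => [|N IHN] S.
  rewrite dot_moment0 big_ord_recl big1 ?addr0 ?bin0 ?mul1r // => k _.
  by rewrite bin0n mul0r.
rewrite dot_momentS IHN big_ord_recl [in RHS]big_ord_recl /= !bin0.
under [X in _ + X]eq_bigr => V _ do rewrite IHN mulr_suml.
rewrite exchange_big /= -addrA; congr (_ + _).
(* The top index [n] has no partner on the right; its term vanishes because a proper subset of [S]
   has fewer than [n] elements. *)
rewrite [X in _ + X]big_ord_recr /= [X in _ + (_ + X)]big1 ?addr0; last first.
  move=> V ltVS; rewrite -mulrA (_ : newton_coef n V * _ = 0) ?mulr0 //.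
  have -> : newton_coef n V = 0; last by rewrite mul0r.
  apply: newton_coef_large; apply: (leq_trans (proper_card ltVS)).
  by rewrite -[X in (_ <= X)%N]card_ord max_card.
rewrite -big_split /=; apply: eq_bigr => k _.
rewrite /bump leq0n add1n binS natrD mulrDl addrC [RHS]addrC; congr (_ + _).
by rewrite mulr_sumr; apply: eq_bigr => V _; rewrite mulrA.
Qed.

(** Only moments in [A] enter, so the polynomial is the same for all choices of copies. *)
Definition dot_poly S : {poly R[i]} :=
  \sum_(k < n.+1) newton_coef k S *: binomial_poly _ k.

Lemma horner_dot_poly (N : nat) S :
  (dot_poly S).[N%:R] = dot_moment cp X N S.
Proof.
rewrite dot_moment_newton horner_sum; apply: eq_bigr => k _.
by rewrite hornerZ horner_binomial_poly mulrC.
Qed.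

Lemma dot_poly_coef0 S : (dot_poly S)`_0 = (S == set0)%:R.
Proof. by rewrite -horner_coef0 -(dot_moment0 X cp) -horner_dot_poly. Qed.

Lemma dot_poly_set0 : dot_poly set0 = 1.
Proof.
by apply: poly_eq_on_nat => N; rewrite horner_dot_poly dot_moment_set0 hornerC.
Qed.

Lemma dot_poly_add (N : nat) S :
  dot_poly S \Po ('X + N%:R%:P)
    = \sum_(V : {set 'I_n} | V \subset S)
        (dot_poly V).[N%:R] *: \prod_(k < n) dot_poly (gap V S k).
Proof.
apply: poly_eq_on_nat => M; rewrite horner_comp !hornerE -natrD addnC.
rewrite horner_dot_poly dot_moment_add // horner_sum; apply: eq_bigr => V _.
rewrite hornerZ horner_prod horner_dot_poly; congr (_ * _).
apply: eq_bigr => k _; rewrite horner_dot_poly.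
by apply: dot_moment_copies => //; apply: monotone_copies_shift.
Qed.

(** The linear coefficient of [p \Po ('X + N%:R%:P)] is the derivative of [p] at [N]; it is read off
    in [dot_poly_add] for every [N]. *)
Lemma deriv_dot_poly S :
  (dot_poly S)^`() = \sum_(V : {set 'I_n} | V \subset S)
    (\prod_(k < n) dot_poly (gap V S k))`_1 *: dot_poly V.
Proof.
apply: poly_eq_on_nat => N.
have := congr1 (fun p : {poly R[i]} => p`_1) (dot_poly_add N S).
rewrite -[LHS]mulr1n -coef_deriv deriv_comp derivD derivX derivC addr0 mulr1.
rewrite -horner_coef0 horner_comp !hornerE => ->.
rewrite coef_sum horner_sum; apply: eq_bigr => V _.
by rewrite coefZ hornerZ mulrC.
Qed.

(** [dot_poly G] is a witness for [dot_moment_poly], so the default in [monotone_cumulant] does not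
    occur for blocks. *)
Lemma block_cumulantE G : block_cumulant cp X G = (dot_poly G)`_1.
Proof.
apply: monotone_cumulantE => N; rewrite horner_dot_poly /dot_moment.
by rewrite prod_enum_val.
Qed.

(** Put [G = S :\: V]. For an interval [G] the product has one factor [dot_poly G], all others being
    1. Otherwise its linear coefficient is 0: the product is 1 for empty [G], and two factors lack a
    constant term for other [G]. *)
Lemma deriv_dot_poly_interval S :
  (dot_poly S)^`() = \sum_(G : {set 'I_n} | interval_of G S)
    block_cumulant cp X G *: dot_poly (S :\: G).
Proof.
rewrite deriv_dot_poly (reindex_onto (fun G => S :\: G) (fun G => S :\: G)) /=;
  last by move=> V subVS; rewrite setDDr setDv set0U; apply/setIidPr.
rewrite [RHS]big_mkcond [LHS]big_mkcond; apply: eq_bigr => G _ /=.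
rewrite subsetDl setDDr setDv set0U.
rewrite (_ : (S :&: G == G) = (G \subset S)); last by apply/eqP/idP=> /setIidPr.
have [intG|nintG] := boolP (interval_of G S).
  have /interval_ofP[_ subGS _] := intG.
  have [k0 gapk0] := gap_interval intG.
  rewrite subGS block_cumulantE (bigD1 k0) //= gapk0 eqxx big1 ?mulr1 // => k.
  by move=> /negPf nek; rewrite gapk0 nek dot_poly_set0.
case: ifP => // subGS.
have [->|nzG] := eqVneq G set0.
  rewrite big1 => [|k _]; first by rewrite coefC scale0r.
  by rewrite setD0 gap_id dot_poly_set0.
have [k1 [k2 [nek nz1 nz2]]] := gap_not_interval subGS nzG nintG.
by rewrite (coef1_prod_two_roots nek) ?scale0r // dot_poly_coef0 ?(negPf nz1) ?(negPf nz2).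
Qed.

End DotPolynomials.

(** * Adding and removing the largest element of a finite linear ordering *)

Section LinearOrderings.

Variable T : finType.
Implicit Types (P : {set T}) (lam : {set T * T}) (G : T).

Lemma linear_orderingP P lam : reflect
  [/\ forall x y, (x, y) \in lam -> x \in P /\ y \in P,
      forall x, (x, x) \notin lam,
      forall x y z, (x, y) \in lam -> (y, z) \in lam -> (x, z) \in lam
    & forall x y, x \in P -> y \in P -> x != y ->
        ((x, y) \in lam) || ((y, x) \in lam)]
  (linear_ordering P lam).
Proof.
apply: (iffP and4P) => [[/subsetP sub irr tr tot]|[sub irr tr tot]].
  have sub2 x y : (x, y) \in lam -> x \in P /\ y \in P.
    by move/sub; rewrite inE => /andP[].
  split=> // [x|x y z xy yz|x y xP yP].
  - by apply/negP => xx; have [xP _] := sub2 _ _ xx; move/forall_inP/(_ x xP): irr; rewrite xx.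
  - have [xP yP] := sub2 _ _ xy; have [_ zP] := sub2 _ _ yz.
    move: tr => /forall_inP/(_ x xP)/forall_inP/(_ y yP)/forall_inP/(_ z zP).
    by rewrite xy yz.
  - by move: tot => /forall_inP/(_ x xP)/forall_inP/(_ y yP)/implyP.
split.
- by apply/subsetP => -[x y] /sub[xP yP]; rewrite inE xP yP.
- by apply/forall_inP.
- apply/forall_inP => x _; apply/forall_inP => y _; apply/forall_inP => z _.
  by apply/implyP => /andP[]; apply: tr.
- apply/forall_inP => x xP; apply/forall_inP => y yP; apply/implyP; exact: tot.
Qed.

Definition is_top (p : {set T} * {set T * T}) G : bool :=
  (G \in p.1) && [forall x in p.1, (x != G) ==> ((x, G) \in p.2)].

Definition add_top G (p : {set T} * {set T * T}) : {set T} * {set T * T} :=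
  (G |: p.1, p.2 :|: finset.setX p.1 [set G]).

Definition del_top G (p : {set T} * {set T * T}) : {set T} * {set T * T} :=
  (p.1 :\ G, [set q in p.2 | (q.1 != G) && (q.2 != G)]).

Lemma is_top_unique p G G' :
  linear_ordering p.1 p.2 -> is_top p G -> is_top p G' -> G = G'.
Proof.
case/linear_orderingP => _ irr tr _ /andP[GP /forall_inP topG].
move=> /andP[GP' /forall_inP topG']; apply/eqP/negPn/negP => neq.
have GG' := implyP (topG' _ GP) neq.
have := topG _ GP'; rewrite eq_sym neq => /(tr _ _ _ GG').
by rewrite (negPf (irr G)).
Qed.

(** An element with the most elements below it is the top: anything above it would have strictly
    more. *)
Lemma is_top_exists p :
  linear_ordering p.1 p.2 -> p.1 != set0 -> exists G, is_top p G.
Proof.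
case/linear_orderingP => sub irr tr tot /set0Pn[x0 x0P].
pose below x := [set y | (y, x) \in p.2].
case: (@arg_maxnP _ x0 (mem p.1) (fun x => #|below x|) x0P) => G GP maxG.
exists G; rewrite /is_top; move: (GP) => /= ->; apply/forall_inP => x xP; apply/implyP => neq.
have /orP[//|Gx] := tot _ _ xP GP neq.
have /proper_card : below G \proper below x.
  apply/properP; split; last by exists G; rewrite inE // (negPf (irr G)).
  by apply/subsetP => y; rewrite !inE => /tr; apply.
by have := maxG x xP; rewrite /geq /= leqNgt => /negPf->.
Qed.

(** With [del_topK], this provides the bijection used to reindex sums over monotone partitions. *)
Lemma add_topK G p :
  linear_ordering p.1 p.2 -> G \notin p.1 -> del_top G (add_top G p) = p.
Proof.
case: p => P lam /= /linear_orderingP[sub _ _ _] nGP; congr pair.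
  by rewrite setU1K.
apply/setP => -[x y]; rewrite !inE /=.
have [xy|nxy] /= := boolP ((x, y) \in lam).
  have [xP yP] := sub _ _ xy.
  by apply/andP; split; [move: xP|move: yP]; apply: contraTneq => ->.
by case: (y == G); rewrite ?andbF.
Qed.

Lemma del_topK G p :
  linear_ordering p.1 p.2 -> is_top p G -> add_top G (del_top G p) = p.
Proof.
case: p => P lam /= /linear_orderingP[sub irr tr _] /andP[/= GP /forall_inP topG].
congr pair; first by rewrite setD1K.
apply/setP => -[x y]; rewrite !inE /=.
have [->|nyG] := eqVneq y G; last first.
  rewrite andbT andbF orbF; have [->|_] := eqVneq x G; rewrite ?andbT // andbF.
  apply/esym/negP => Gy; have [_ yP] := sub _ _ Gy.
  by move: (irr G); rewrite (tr _ _ _ Gy (implyP (topG _ yP) nyG)).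
rewrite !andbF andbT /=; have [->|nxG] /= := eqVneq x G; first by rewrite (negPf (irr G)).
have [xP|nxP] := boolP (x \in P); first by rewrite (implyP (topG _ xP)).
by apply/esym/negP => /sub[]; rewrite (negPf nxP).
Qed.

Lemma linear_ordering_del_top G p :
  linear_ordering p.1 p.2 ->
  linear_ordering (del_top G p).1 (del_top G p).2.
Proof.
case: p => P lam /= /linear_orderingP[sub irr tr tot]; apply/linear_orderingP; split.
- by move=> x y; rewrite !inE /= => /and3P[/sub[-> ->] -> ->].
- by move=> x; rewrite inE /= (negPf (irr x)).
- move=> x y z; rewrite !inE /= => /and3P[xy -> _] /and3P[yz _ ->].
  by rewrite (tr _ _ _ xy yz).
- move=> x y; rewrite !inE /= => /andP[-> xP] /andP[-> yP] /(tot _ _ xP yP).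
  by rewrite !andbT.
Qed.

Lemma linear_ordering_add_top G p :
  linear_ordering p.1 p.2 -> G \notin p.1 ->
  linear_ordering (add_top G p).1 (add_top G p).2.
Proof.
case: p => P lam /= /linear_orderingP[sub irr tr tot] nGP; apply/linear_orderingP; split.
- move=> x y; rewrite !inE /= => /orP[/sub[-> ->]|/andP[-> /eqP->]]; first by rewrite !orbT.
  by rewrite eqxx orbT.
- move=> x; rewrite !inE /= (negPf (irr x)) /=.
  by have [->|] := eqVneq x G; rewrite ?andbF // (negPf nGP).
- move=> x y z; rewrite !inE /= => /orP[xy|/andP[xP /eqP->]].
    case/orP=> [yz|/andP[_ ->]]; first by rewrite (tr _ _ _ xy yz).
    by have [-> _] := sub _ _ xy; rewrite orbT.
  case/orP=> [/sub[]|/andP[]]; by rewrite (negPf nGP).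
- move=> x y; rewrite !inE /= => /orP[/eqP->|xP] /orP[/eqP->|yP].
  + by rewrite eqxx.
  + by rewrite yP eqxx orbT orbT.
  + by rewrite xP eqxx orbT.
  + by move=> /(tot _ _ xP yP)/orP[->|->]; rewrite ?orbT.
Qed.

Lemma is_top_add_top G p : is_top (add_top G p) G.
Proof.
rewrite /is_top /= !inE eqxx; apply/forall_inP => x; rewrite !inE.
by case/orP=> [->//|->]; rewrite eqxx orbT implybT.
Qed.

End LinearOrderings.

(** * Monotone partitions of a subset and their largest block *)

Section MonotonePartitions.

Variable n : nat.
Implicit Types (S V W G : {set 'I_n}) (pi : {set {set 'I_n}}).

Lemma noncrossingP pi : reflect
  (forall V W (a b c d : 'I_n), V \in pi -> W \in pi -> V != W ->
     a \in V -> b \in W -> c \in V -> d \in W -> (a < b < c)%N -> (d <= c)%N)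
  (noncrossing pi).
Proof.
apply: (iffP forall_inP) => [nc V W a b c d VP WP neq aV bW cV dW /andP[ltab ltbc]|nc V VP].
  rewrite leqNgt; apply/negP => ltcd; move: (nc V VP) => /forall_inP/(_ W WP).
  rewrite neq => /exists_inP[]; exists a => //; apply/exists_inP; exists b => //.
  apply/exists_inP; exists c => //; apply/exists_inP; exists d => //.
  by rewrite ltab ltbc.
apply/forall_inP => W WP; apply/implyP => neq; apply/exists_inP => -[a aV].
move=> /exists_inP[b bW /exists_inP[c cV /exists_inP[d dW /and3P[ltab ltbc]]]].
by rewrite ltnNge (nc V W a b c d) // ltab.
Qed.

Lemma nested_inP V W : reflect
  (exists i j, [/\ i \in W, j \in W & forall k, k \in V -> (i < k < j)%N])
  (nested_in V W).
Proof.
apply: (iffP exists_inP) => [[i iW /exists_inP[j jW /forall_inP VW]]|[i [j [iW jW VW]]]].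
  by exists i, j.
by exists i => //; apply/exists_inP; exists j => //; apply/forall_inP.
Qed.

(** Relative to a subset [S] of a fixed index set, so that blocks can be removed without
    renumbering. *)
Definition monotone_partition_of S
    (p : {set {set 'I_n}} * {set {set 'I_n} * {set 'I_n}}) : bool :=
  [&& finset.partition p.1 S, linear_ordering p.1 p.2, noncrossing p.1
    & [forall V in p.1, forall W in p.1, nested_in V W ==> ((W, V) \in p.2)]].

Lemma monotone_partition_ofP S p : reflect
  [/\ finset.partition p.1 S, linear_ordering p.1 p.2, noncrossing p.1
    & forall V W, V \in p.1 -> W \in p.1 -> nested_in V W -> (W, V) \in p.2]
  (monotone_partition_of S p).
Proof.
apply: (iffP and4P) => -[? ? ? nest]; split=> //.
  by move=> V W VP WP; apply/implyP; move: nest => /forall_inP/(_ V VP)/forall_inP; apply.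
apply/forall_inP => V VP; apply/forall_inP => W WP; apply/implyP; exact: nest.
Qed.

(** If an element of [S] outside [G] lay between two elements of [G], non-crossing would trap its
    whole block there. That block would be nested in [G], hence above it, against maximality. *)
Lemma interval_top S p G :
  monotone_partition_of S p -> is_top p G -> interval_of G S.
Proof.
case/monotone_partition_ofP => part lin /noncrossingP nc nest topG.
have [GP /forall_inP maxG] := andP topG.
have [_ irr tr _] := linear_orderingP _ _ lin.
apply/interval_ofP; split; first exact: partition_neq0 part GP.
  exact: partitionS part GP.
move=> a b c aG bG cS ltac ltcb; apply/negPn/negP => ncG.
have := cS; rewrite -(cover_partition part) => /bigcupP[V VP cV].
have disj x : x \in G -> x \in V -> False.
  move=> xG xV; have triv := partition_trivIset part.
  by rewrite -(def_pblock triv GP xG) (def_pblock triv VP xV) cV in ncG.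
have neq : V != G by apply: contraNneq ncG => <-.
have nestVG : nested_in V G.
  apply/nested_inP; exists a, b; split=> // k kV; apply/andP; split.
    rewrite ltnNge leq_eqVlt; apply/negP => /orP[/eqP/val_inj eka|ltka].
      by apply: (disj a) => //; rewrite -eka.
    have := nc _ _ k a c b VP GP neq kV aG cV bG.
    by rewrite ltka ltac leqNgt ltcb => /(_ isT).
  rewrite ltnNge leq_eqVlt; apply/negP => /orP[/eqP/val_inj ebk|ltbk].
    by apply: (disj b) => //; rewrite ebk.
  have := nc _ _ a c b k GP VP _ aG cV bG kV; rewrite eq_sym neq ltac ltcb.
  by rewrite leqNgt ltbk => /(_ isT isT).
have VG := implyP (maxG _ VP) neq.
by move: (irr G); rewrite (tr _ _ _ (nest _ _ VP GP nestVG) VG).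
Qed.

Lemma monotone_del_top S p G :
  monotone_partition_of S p -> is_top p G ->
  monotone_partition_of (S :\: G) (del_top G p).
Proof.
case/monotone_partition_ofP => part lin /noncrossingP nc nest topG.
have [GP _] := andP topG; apply/monotone_partition_ofP; split.
- exact: partitionD1.
- exact: linear_ordering_del_top.
- apply/noncrossingP => V W a b c d; rewrite !inE => /andP[_ VP] /andP[_ WP].
  exact: nc.
- move=> V W; rewrite !inE => /andP[nVG VP] /andP[nWG WP] nVW.
  by rewrite nest //= nVG nWG.
Qed.

(** An interval crosses no other block and has none nested in it; placed on top, it respects the
    order condition for each block enclosing it. *)
Lemma monotone_add_top S p G :
  interval_of G S -> monotone_partition_of (S :\: G) p ->
  monotone_partition_of S (add_top G p).
Proof.
case/interval_ofP => nzG subGS int.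
case/monotone_partition_ofP => part lin /noncrossingP nc nest.
have sub V x : V \in p.1 -> x \in V -> x \in S /\ x \notin G.
  move=> VP xV; have /subsetP/(_ x xV) := partitionS part VP.
  by rewrite inE => /andP[].
have nGP : G \notin p.1.
  by apply/negP => GP; have /set0Pn[x xG] := nzG; have [] := sub _ _ GP xG; rewrite xG.
apply/monotone_partition_ofP; split.
- rewrite /= -(setID S G) (setIidPr subGS); apply: partitionU1 => //.
  by rewrite disjoints_subset setCD subsetUr.
- exact: linear_ordering_add_top.
- apply/noncrossingP => V W a b c d; rewrite !inE.
  case/orP=> [/eqP->|VP] /orP[/eqP->|WP]; rewrite ?eqxx // => neq aV bW cV dW.
  + move=> /andP[ltab ltbc]; have [bS nbG] := sub _ _ WP bW.
    by rewrite (int a c b) in nbG.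
  + move=> /andP[ltab ltbc]; rewrite leqNgt; apply/negP => ltcd.
    have [cS ncG] := sub _ _ VP cV.
    by rewrite (int b d c) in ncG.
  + exact: nc neq aV bW cV dW.
- move=> V W; rewrite !inE /= => /orP[/eqP->|VP] /orP[/eqP->|WP].
  + case/nested_inP => i [j [iG _ /(_ i iG)]]; by rewrite ltnn.
  + by rewrite WP eqxx orbT.
  + case/nested_inP => i [j [iG jG VG]].
    have /set0Pn[x xV] := partition_neq0 part VP.
    have [xS] := sub _ _ VP xV; have /andP[ltix ltxj] := VG x xV.
    by rewrite (int i j x).
  + by move=> /(nest _ _ VP WP) ->.
Qed.

(** Made total with default [set0] so that sums can be grouped by its value. *)
Definition top_block (p : {set {set 'I_n}} * {set {set 'I_n} * {set 'I_n}}) :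
    {set 'I_n} :=
  odflt set0 [pick G | is_top p G].

Lemma top_blockP p :
  linear_ordering p.1 p.2 -> p.1 != set0 -> is_top p (top_block p).
Proof.
move=> lin nz; rewrite /top_block; case: pickP => //= no_top.
by have [G] := is_top_exists lin nz; rewrite no_top.
Qed.

Lemma top_block_eq p G :
  linear_ordering p.1 p.2 -> is_top p G -> top_block p = G.
Proof.
move=> lin topG; apply: (is_top_unique lin _ topG); apply: top_blockP => //.
by apply/set0Pn; exists G; case/andP: topG.
Qed.

(* A monotone partition of a nonempty set is its top block, which is an interval
   of that set, placed above a monotone partition of the rest. *)
Lemma sum_monotone_partitions (T : nmodType) S (k : nat)
    (F : {set {set 'I_n}} * {set {set 'I_n} * {set 'I_n}} -> T) :
  \sum_(p | monotone_partition_of S p && (#|p.1| == k.+1)) F p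
    = \sum_(G | interval_of G S)
        \sum_(p | monotone_partition_of (S :\: G) p && (#|p.1| == k))
          F (add_top G p).
Proof.
have topP p : monotone_partition_of S p && (#|p.1| == k.+1) -> is_top p (top_block p).
  case/andP => /monotone_partition_ofP[_ lin _ _] /eqP cardp.
  by apply: top_blockP => //; rewrite -card_gt0 cardp.
rewrite (partition_big top_block (fun G => interval_of G S)) => [|p Pp] /=; last first.
  by have /andP[monp _] := Pp; exact: interval_top (topP _ Pp).
apply: eq_bigr => G intG.
rewrite (reindex_onto (add_top G) (del_top G)) /= => [|p /andP[Pp /eqP topG]].
  apply: eq_bigl => p; apply/idP/idP.
    case/andP => /andP[/andP[monp cardp] _] /eqP eqp.
    have topG := is_top_add_top G p.
    (* By [eqp], deleting [G] from [add_top G p] gives back [p], so [G] is not already a block of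
       [p]. *)
    have nGp : G \notin p.1 by rewrite -eqp !inE eqxx.
    have := monotone_del_top monp topG; rewrite eqp => ->.
    by move: cardp; rewrite /= cardsU1 nGp.
  case/andP => monp cardp; have [part lin _ _] := monotone_partition_ofP _ _ monp.
  have nGp : G \notin p.1.
    have /interval_ofP[/set0Pn[x xG] _ _] := intG.
    apply/negP => /(partitionS part)/subsetP/(_ x xG).
    by rewrite inE xG.
  rewrite (monotone_add_top intG monp) cardsU1 nGp (eqP cardp) eqxx add_topK // eqxx /= andbT.
  apply/eqP/top_block_eq; last exact: is_top_add_top.
  exact: linear_ordering_add_top.
have /andP[/monotone_partition_ofP[_ lin _ _] _] := Pp.
by rewrite del_topK // -topG; apply: topP.
Qed.

Lemma monotone_partition_of_set0 S p :
  monotone_partition_of S p && (#|p.1| == 0%N)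
    = (S == set0) && (p == (set0, set0)).
Proof.
apply/andP/andP => [[/monotone_partition_ofP[part lin _ _]]|[/eqP-> /eqP->]].
  rewrite cards_eq0 => /eqP p0; case: p p0 part lin => P lam /= ->.
  move=> part /linear_orderingP[sub _ _ _]; split.
    by rewrite -(cover_partition part) /cover big_set0.
  rewrite xpair_eqE eqxx; apply/eqP/setP => -[V W]; rewrite inE.
  by apply/negP => /sub[]; rewrite inE.
split; last by rewrite cards0.
apply/monotone_partition_ofP; split=> /=.
- by rewrite partition_set0.
- by apply/linear_orderingP; split=> // [x y|x|x y z|x y]; rewrite !inE.
- by apply/noncrossingP => V W a b c d; rewrite inE.
- by move=> V W; rewrite inE.
Qed.

Lemma mem_monotone_partitions p :
  (p \in monotone_partitions n) = monotone_partition_of [set: 'I_n] p.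
Proof.
by rewrite inE /ordered_partition /monotone_partition_of -andbA.
Qed.

End MonotonePartitions.

(** * Coefficients of the moment polynomials and the moment-cumulant formula *)

Section MonotoneMomentCumulant.

Variables (R : realType) (A B : algProbSpace R) (cp : nat -> A -> B).
Hypothesis hcp : monotone_copies cp.
Variables (n : nat) (X : 'I_n -> A).

(** Induction on [k]: the coefficient of degree [k + 1], times [k + 1], is one of the derivative.
    [deriv_dot_poly_interval] expands it over intervals just as [sum_monotone_partitions] expands
    the right side over top blocks. *)
Lemma coef_dot_poly (k : nat) (S : {set 'I_n}) :
  (dot_poly X S)`_k = \sum_(p | monotone_partition_of S p && (#|p.1| == k))
    (k`!%:R)^-1 * partition_cumulant cp X p.1.
Proof.
elim: k S => [|k IHk] S.
  under eq_bigl do rewrite monotone_partition_of_set0.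
  rewrite (dot_poly_coef0 hcp); have [_|_] := eqVneq S set0; last by rewrite big_pred0.
  by rewrite big_pred1_eq fact0 invr1 mul1r /partition_cumulant big_set0.
rewrite sum_monotone_partitions.
have nzk : k.+1%:R != 0 :> R[i] by rewrite pnatr_eq0.
apply: (mulIf nzk); rewrite mulr_natr -coef_deriv (deriv_dot_poly_interval hcp).
rewrite coef_sum mulr_suml; apply: eq_bigr => G intG.
rewrite coefZ IHk mulr_sumr mulr_suml; apply: eq_bigr => p /andP[monp _].
have [part _ _ _] := monotone_partition_ofP _ _ monp.
have nGp : G \notin p.1.
  have /interval_ofP[/set0Pn[x xG] _ _] := intG.
  apply/negP => /(partitionS part)/subsetP/(_ x xG).
  by rewrite inE xG.
rewrite /partition_cumulant /= big_setU1 //= factS natrM invfM mulrCA.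
by rewrite [RHS]mulrC !mulrA mulfV // mul1r.
Qed.

Lemma moment_monotone_partitions (S : {set 'I_n}) :
  moment X S = \sum_(p | monotone_partition_of S p)
    ((#|p.1|)`!%:R)^-1 * partition_cumulant cp X p.1.
Proof.
pose c (p : {set {set 'I_n}} * {set {set 'I_n} * {set 'I_n}}) : R[i] :=
  ((#|p.1|)`!%:R)^-1 * partition_cumulant cp X p.1.
have -> : moment X S = (dot_poly X S).[1%:R].
  by rewrite (horner_dot_poly hcp) dot_moment1.
have -> : dot_poly X S = \sum_(p | monotone_partition_of S p) c p *: 'X^#|p.1|.
  apply/polyP => k; rewrite coef_dot_poly coef_sum big_mkcondr /=.
  apply: eq_bigr => p _; rewrite coefZ coefXn /c eq_sym.
  by case: eqP => [->|_]; rewrite ?mulr1 ?mulr0.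
by rewrite horner_sum; apply: eq_bigr => p _; rewrite hornerZ hornerXn expr1n mulr1.
Qed.

End MonotoneMomentCumulant.

Theorem theorem5p3 (R : realType) (A B : algProbSpace R) (cp : nat -> A -> B)
    (hcp : monotone_copies cp) (n : nat) (hn : (0 < n)%N) (X : 'I_n -> A) :
  state A (\prod_(i < n) X i)
    = \sum_(p in monotone_partitions n)
        ((#|p.1|)`!%:R)^-1 * partition_cumulant cp X p.1.
Proof.
rewrite (eq_bigl _ _ (@mem_monotone_partitions n)) -moment_monotone_partitions //.
by rewrite /moment; congr (state A _); apply: eq_bigl => i; rewrite inE.
Qed.
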